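(* Let $M\in\mathbb{R}^{n\times n}$, where $n=2\nu$ is even. Then $M\in MPS_n$ if and only if there are vectors $a,b\in\{1_\nu\}^\bot$ with $\mathcal{J}_\nu a=-a$, $\mathcal{J}_\nu b=-b$ if $\nu$ is even, and $\mathcal{J}_\nu a=a$, $\mathcal{J}_\nu b=b$ if $\nu$ is odd, and a matrix $Z\in A_\nu\cap M_\nu$, such that $$M=\mathcal{X}_n\begin{pmatrix}\mathcal{O}_\nu&a\sigma_\nu^T\\ \sigma_\nu b^T&Z\end{pmatrix}\mathcal{X}_n.$$
   Context: $1_m\in\mathbb{R}^m$ is the all-ones column vector, $\sigma_m\in\mathbb{R}^m$ the column vector with $j$th entry $(-1)^{j-1}$; $X^\bot=\{u\in\mathbb{R}^m\mid u^Tv=0\ (v\in X)\}$ for $X\subset\mathbb{R}^m$. $\mathcal{O}_\nu$, $\mathcal{I}_\nu$ are the $\nu\times\nu$ null and unit matrices, $\mathcal{J}_\nu=(\delta_{i,\nu+1-j})_{i,j=1}^\nu$, and for $n=2\nu$, $\mathcal{X}_n=\frac1{\sqrt2}\begin{pmatrix}\mathcal{I}_\nu&\mathcal{J}_\nu\\ \mathcal{J}_\nu&-\mathcal{I}_\nu\end{pmatrix}$. $MPS_n=M_n\cap P_n\cap S_n$ for even $n$ (weightless most perfect square matrices). The spaces of matrices $M\in\mathbb{R}^{m\times m}$ are, with indices in $\mathbb{Z}_m=\mathbb{Z}/m\mathbb{Z}$ (modulo $m$): $S_m$: there is $w\in\mathbb{R}$ with $\sum_jM_{i,j}=\sum_jM_{j,i}=mw$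 for all $i$. $A_m$: $M_{i,j}+M_{m+1-i,m+1-j}=0$ for all $i,j$. $P_m$ ($m=2\mu$ even): $M_{i,j}+M_{i+\mu,j+\mu}=0$ for all $i,j$. $M_m$ ($m$ even): $M_{i,j}+M_{i,j+1}+M_{i+1,j}+M_{i+1,j+1}=0$ for all $i,j\in\mathbb{Z}_m$ and $\sum_{i,j\in\mathbb{Z}_m}(-1)^{i+j}M_{i,j}=0$. $M_m$ ($m$ odd): $u^TMv=0$ for all $u,v\in\{\sigma_m\}^\bot$ and $\sigma_m^TM\sigma_m=0$. *)

(* Defs.v *)
(* The entries of vectors and matrices are numbered from 0: the 1-based index
   k is the ordinal with value k - 1, so the reflection m + 1 - k is rev_ord,
   and sums of indices keep their parity. *)
From HB Require Import structures.
From mathcomp Require Import all_boot all_order all_algebra.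
From mathcomp Require Import classical_sets reals.

Set Implicit Arguments.
Unset Strict Implicit.
Unset Printing Implicit Defensive.

Import Order.TTheory GRing.Theory Num.Theory.

Local Open Scope classical_set_scope.
Local Open Scope ring_scope.

Lemma cyc_shift_subproof (m k : nat) (i : 'I_m) : ((i + k) %% m < m)%N.
Proof. by rewrite ltn_mod (leq_ltn_trans (leq0n i) (ltn_ord i)). Qed.

(* i + k in Z/mZ; 'Z_m is avoided because it is not Z/mZ for m < 2. *)
Definition cyc_shift (m k : nat) (i : 'I_m) : 'I_m :=
  Ordinal (cyc_shift_subproof k i).

Section Spaces.
Variable R : realType.

Definition ones (m : nat) : 'cV[R]_m := const_mx 1.

Definition sigma (m : nat) : 'cV[R]_m := \col_j (-1) ^+ j.

Definition perp (m : nat) (X : set 'cV[R]_m) : set 'cV[R]_m :=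
  [set u | forall v, X v -> u^T *m v = 0].

Definition Jmx (m : nat) : 'M[R]_m := \matrix_(i, j) (i == rev_ord j)%:R.

Definition Xmx (nu : nat) : 'M[R]_(nu + nu) :=
  (Num.sqrt 2)^-1 *: block_mx 1%:M (Jmx nu) (Jmx nu) (- 1%:M).

Definition spaceS (m : nat) : set 'M[R]_m :=
  [set M : 'M[R]_m | exists w : R, forall i,
     \sum_j M i j = m%:R * w /\ \sum_j M j i = m%:R * w].

Definition spaceA (m : nat) : set 'M[R]_m :=
  [set M : 'M[R]_m | forall i j, M i j + M (rev_ord i) (rev_ord j) = 0].

(* Only even orders are meaningful here, so the order is given as mu + mu. *)
Definition spaceP (mu : nat) : set 'M[R]_(mu + mu) :=
  [set M : 'M[R]_(mu + mu) | forall i j,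
     M i j + M (cyc_shift mu i) (cyc_shift mu j) = 0].

Definition spaceM_even (m : nat) : set 'M[R]_m :=
  [set M : 'M[R]_m |
     (forall i j, M i j + M i (cyc_shift 1 j) + M (cyc_shift 1 i) j
                    + M (cyc_shift 1 i) (cyc_shift 1 j) = 0)
     /\ \sum_(i < m) \sum_(j < m) (-1) ^+ (i + j)%N * M i j = 0].

Definition spaceM_odd (m : nat) : set 'M[R]_m :=
  [set M : 'M[R]_m |
     (forall u v, perp [set sigma m] u -> perp [set sigma m] v ->
        u^T *m M *m v = 0)
     /\ (sigma m)^T *m M *m sigma m = 0].

Definition spaceM (m : nat) : set 'M[R]_m :=
  if odd m then @spaceM_odd m else @spaceM_even m.

Definition spaceMPS (nu : nat) : set 'M[R]_(nu + nu) :=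
  @spaceM (nu + nu) `&` @spaceP nu `&` @spaceS (nu + nu).

End Spaces.

Arguments ones R m : clear implicits.
Arguments sigma R m : clear implicits.
Arguments Jmx R m : clear implicits.
Arguments Xmx R nu : clear implicits.
Arguments spaceS R m : clear implicits.
Arguments spaceA R m : clear implicits.
Arguments spaceP R mu : clear implicits.
Arguments spaceM_even R m : clear implicits.
Arguments spaceM_odd R m : clear implicits.
Arguments spaceM R m : clear implicits.
Arguments spaceMPS R nu : clear implicits.

(* Main.v *)
(* Writing s for the alternating vector, the space M_m consists, for both
   parities of m, of the matrices x s^T + s y^T with x, y orthogonal to s, and
   this representation is unique. Together with P and S it forces
   x = (p, -e p), y = (q, -e q) with e = (-1)^nu and x, y orthogonal to ones.
   Conjugation by the symmetric involution X sends s to a multiple of (0, s), so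
   x s^T + s y^T becomes the stated block form with a = J p - e p and
   Z = z s^T + s w^T, z = - (p + e J p). The components a and z of p are its
   projections on the two eigenspaces of J up to scaling, so p is recovered
   from (a, z). *)
Require Import Defs.
From HB Require Import structures.
From mathcomp Require Import all_boot all_order all_algebra.
From mathcomp Require Import classical_sets reals.
From mathcomp Require Import ring.

Set Implicit Arguments.
Unset Strict Implicit.
Unset Printing Implicit Defensive.

Import Order.TTheory GRing.Theory Num.Theory.

Local Open Scope classical_set_scope.
Local Open Scope ring_scope.

(** * Dyadic sums built on the alternating vector, and their uniqueness *)

Lemma perp_set1 (R : realType) m (v u : 'cV[R]_m) :
  perp [set v] u <-> v^T *m u = 0.
Proof.
split=> [/(_ v erefl) vu|vu _ ->]; apply: trmx_inj;
  by rewrite trmx_mul trmxK trmx0.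
Qed.

Lemma sqr_sigma (R : realType) m :
  (sigma R m)^T *m sigma R m = m%:R%:M.
Proof.
rewrite [LHS]mx11_scalar; congr (_%:M).
rewrite mxE -[in RHS](card_ord m) -sumr_const; apply: eq_bigr => i _.
by rewrite !mxE -expr2 sqrr_sign.
Qed.

Definition dyad_sum (R : realType) m (x y : 'cV[R]_m) : 'M[R]_m :=
  x *m (sigma R m)^T + sigma R m *m y^T.

Lemma dyad_sum_sigma (R : realType) m (x y : 'cV[R]_m) :
  (sigma R m)^T *m y = 0 -> dyad_sum x y *m sigma R m = m%:R *: x.
Proof.
move=> sy; rewrite /dyad_sum mulmxDl -!mulmxA sqr_sigma mul_mx_scalar.
by rewrite -[y^T *m _]trmxK trmx_mul trmxK sy trmx0 mulmx0 addr0.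
Qed.

Lemma tr_dyad_sum (R : realType) m (x y : 'cV[R]_m) :
  (dyad_sum x y)^T = dyad_sum y x.
Proof. by rewrite /dyad_sum linearD /= !trmx_mul !trmxK addrC. Qed.

(** Uniqueness of the representation: multiplying by [sigma] recovers m x, and the transpose
    recovers m y. Below, this splits matrix equations into equations for the two vectors. *)
Lemma dyad_sum_eq0 (R : realType) m (x y : 'cV[R]_m) :
  (sigma R m)^T *m x = 0 -> (sigma R m)^T *m y = 0 ->
  dyad_sum x y = 0 -> x = 0 /\ y = 0.
Proof.
case: m x y => [|m] x y sx sy xy0; first by split; apply: flatmx0.
have m0 : m.+1%:R != 0 :> R by rewrite pnatr_eq0.
split; apply/eqP; rewrite -(inj_eq (scalerI m0)) scaler0.
  by rewrite -(dyad_sum_sigma _ sy) xy0 mul0mx.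
by rewrite -(dyad_sum_sigma _ sx) -tr_dyad_sum xy0 trmx0 mul0mx.
Qed.

(** * The space M as dyadic sums, in both parities *)

(** The first condition says Q M Q = 0 for the projection Q along s = [sigma]; expanding this, with
    s^T M s = 0 removing the term quadratic in s, leaves the two dyads. *)
Lemma spaceM_oddP (R : realType) m (M : 'M[R]_m) :
  spaceM_odd R m M <->
  exists x y, [/\ (sigma R m)^T *m x = 0, (sigma R m)^T *m y = 0 &
    M = dyad_sum x y].
Proof.
split=> [[uMv sMs]|[x [y [sx sy ->]]]]; last first.
  split=> [u v /perp_set1 su /perp_set1 sv|].
    have us : u^T *m sigma R m = 0
      by apply: trmx_inj; rewrite trmx_mul trmxK su trmx0.
    rewrite /dyad_sum mulmxDr mulmxDl !mulmxA us !mul0mx addr0.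
    by rewrite -!mulmxA sv !mulmx0.
  by rewrite -mulmxA dyad_sum_sigma // -scalemxAr sx scaler0.
case: m M uMv sMs => [|m] M uMv sMs.
  by exists 0, 0; rewrite !mulmx0 [M]flatmx0 [dyad_sum _ _]flatmx0.
have m0 : m.+1%:R != 0 :> R by rewrite pnatr_eq0.
set s := sigma R m.+1 in uMv sMs *; set c := m.+1%:R in m0.
have sMTs : s^T *m M^T *m s = 0.
  by apply: trmx_inj; rewrite !trmx_mul !trmxK mulmxA sMs trmx0.
(* These witnesses are forced by [dyad_sum_sigma] and its transpose. *)
exists (c^-1 *: (M *m s)), (c^-1 *: (M^T *m s)).
split; rewrite -?scalemxAr ?mulmxA ?sMs ?sMTs ?scaler0 //.
(* Q is the orthogonal projection onto the complement of s. *)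
pose Q : 'M[R]_m.+1 := 1%:M - c^-1 *: (s *m s^T).
have sQ : s^T *m Q = 0.
  rewrite mulmxBr mulmx1 -scalemxAr mulmxA sqr_sigma mul_scalar_mx.
  by rewrite scalerA mulVf // scale1r subrr.
have QMQ : Q^T *m M *m Q = 0.
  (* Each entry is u^T M v for two columns u, v of Q, which are orthogonal to s. *)
  apply/matrixP => i j; rewrite [in RHS]mxE.
  have: (col i Q)^T *m M *m col j Q = 0.
    by apply: uMv; apply/perp_set1; rewrite colE mulmxA sQ mul0mx.
  move=> /matrixP/(_ 0 0).
  rewrite -[X in _ = X]mul1r mxE [X in _ = _ * X]mxE mulr0 => <-.
  rewrite tr_col -row_mul mxE; apply: eq_bigr => k _.
  by rewrite !mxE.
have QT : Q^T = Q by rewrite linearB /= linearZ /= trmx_mul trmxK trmx1.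
have MQ : M *m Q = M - c^-1 *: (M *m s) *m s^T.
  by rewrite mulmxBr mulmx1 -scalemxAr -scalemxAl mulmxA.
have sMQ : s^T *m M *m Q = s^T *m M.
  by rewrite mulmxBr mulmx1 -scalemxAr mulmxA sMs mul0mx scaler0 subr0.
move: QMQ; rewrite QT -mulmxA {1}/Q mulmxBl mul1mx -scalemxAl -mulmxA.
rewrite [s^T *m (M *m Q)]mulmxA sMQ MQ /dyad_sum.
have -> : (c^-1 *: (M^T *m s))^T = c^-1 *: (s^T *m M).
  by rewrite linearZ /= trmx_mul trmxK.
rewrite -scalemxAr.
by move/eqP; rewrite -addrA -opprD subr_eq0 => /eqP.
Qed.

(** Mixed second differences vanish, so three corners of a unit square determine the fourth; double
    induction spreads the additive form from the first row and column. *)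
Lemma additive_of_squares (A : comNzRingType) (F : nat -> nat -> A) m :
  (forall i j, (i.+1 < m)%N -> (j.+1 < m)%N ->
     F i j + F i.+1 j.+1 = F i.+1 j + F i j.+1) ->
  forall i j, (i < m)%N -> (j < m)%N -> F i j = F i 0%N + F 0%N j - F 0%N 0%N.
Proof.
move=> sq; elim=> [|i IHi] j im jm; first by ring.
elim: j jm => [|j IHj] jm; first by ring.
have i_m := ltnW im; have j_m := ltnW jm.
have := sq i j im jm; rewrite (IHj j_m) (IHi j i_m j_m) (IHi j.+1 i_m jm).
by move=> /(canRL (addKr _)) ->; ring.
Qed.

Lemma sigma_shift1 (R : realType) m (i : 'I_m) :
  ~~ odd m -> sigma R m (cyc_shift 1 i) 0 = - sigma R m i 0.
Proof.
move=> em; rewrite !mxE /= addn1.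
have [im|im|im] := ltngtP i.+1 m.
- by rewrite modn_small // exprS mulN1r.
- by move: (ltn_ord i); rewrite leqNgt im.
(* At the wrap from m - 1 to 0 the sign still flips, because m is even. *)
- have oi : odd i by rewrite -im /= negbK in em.
  by rewrite im modnn -[in RHS]signr_odd oi expr1 opprK.
Qed.

Lemma sigma_quad (R : realType) m (M : 'M[R]_m) :
  (sigma R m)^T *m M *m sigma R m =
  (\sum_(i < m) \sum_(j < m) (-1) ^+ (i + j)%N * M i j)%:M.
Proof.
rewrite [LHS]mx11_scalar; congr (_%:M).
rewrite mxE exchange_big /=; apply: eq_bigr => j _.
rewrite mxE mulr_suml; apply: eq_bigr => i _; rewrite !mxE exprD; ring.
Qed.

Lemma scalar11_eq0 (R : realType) (c : R) : (c%:M = 0 :> 'M_1) <-> c = 0.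
Proof.
split=> [/matrixP/(_ 0 0)|->]; last by apply/matrixP=> i j; rewrite !mxE mul0rn.
by rewrite !mxE eqxx mulr1n.
Qed.

(** Dyadic sums satisfy the cyclic 2 x 2 conditions since s alternates around the whole cycle.
    Conversely, the checkerboard signs turn these conditions into vanishing mixed differences. *)
Lemma spaceM_even_odd (R : realType) m (M : 'M[R]_m) :
  ~~ odd m -> spaceM_even R m M <-> spaceM_odd R m M.
Proof.
move=> em; rewrite spaceM_oddP; split; last first.
  move=> Mxy; have [_ /=] := (spaceM_oddP M).2 Mxy.
  rewrite sigma_quad => /scalar11_eq0 sMs; split=> // i j.
  have [x [y [_ _ ->]]] := Mxy.
  have E k l : dyad_sum x y k l =
      x k 0 * sigma R m l 0 + sigma R m k 0 * y l 0.
    by rewrite mxE !mxE !big_ord1 !mxE.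
  rewrite !E !sigma_shift1 //; ring.
move=> [adj sMs]; apply/spaceM_oddP.
split; last by rewrite sigma_quad; apply/scalar11_eq0.
case: m em M adj sMs => [|m] em M adj _ u v /perp_set1 su /perp_set1 sv.
  by rewrite [M]flatmx0 mulmx0 mul0mx.
(* With the checkerboard signs, M becomes a sum f i + g j. *)
pose F i j : R := (-1) ^+ (i + j) * M (inord i) (inord j).
have Fadd := @additive_of_squares R F m.+1.
have sq : forall i j, (i.+1 < m.+1)%N -> (j.+1 < m.+1)%N ->
     F i j + F i.+1 j.+1 = F i.+1 j + F i j.+1.
  move=> i j im jm.
  (* Within this bound the cyclic shift does not wrap and [inord] does not fall back to its
     default. *)
  have sh k : (k.+1 < m.+1)%N -> cyc_shift 1 (inord k : 'I_m.+1) = inord k.+1.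
    move=> km; apply: val_inj.
    by rewrite /= !inordK // 1?ltnW // addn1 modn_small.
  have := adj (inord i) (inord j).
  rewrite !sh // /F addSnnS !addnS addSn !exprS => h.
  (* The difference of the two sides is (-1)^(i+j) times the 2 x 2 sum in [h]. *)
  apply/eqP; rewrite -subr_eq0 -[X in _ == X](mulr0 ((-1) ^+ (i + j))) -h.
  by apply/eqP; ring.
have {sq Fadd} := Fadd sq; set s := sigma R m.+1 in su sv * => Fadd.
(* Undoing the signs makes s a factor of both terms; the constant F 0 0 is absorbed in the column
   factor. *)
have -> : M = (\col_i (s i 0 * (F i 0%N - F 0%N 0%N))) *m s^T
             + s *m (\row_j (s j 0 * F 0%N j)).
  apply/matrixP=> i j; rewrite !mxE !big_ord1 !mxE.
  transitivity ((-1) ^+ i * (-1) ^+ j * F i j).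
    by rewrite /F exprD !inord_val mulrA mulrACA -!expr2 !sqrr_sign mulr1 mul1r.
  rewrite (Fadd i j) //; ring.
rewrite mulmxDr mulmxDl !mulmxA -!mulmxA sv !mulmx0 add0r.
have us : u^T *m s = 0 by apply: trmx_inj; rewrite trmx_mul trmxK su trmx0.
by rewrite mulmxA us mul0mx.
Qed.

Lemma spaceMP (R : realType) m (M : 'M[R]_m) :
  spaceM R m M <->
  exists x y, [/\ (sigma R m)^T *m x = 0, (sigma R m)^T *m y = 0 &
    M = dyad_sum x y].
Proof.
rewrite /spaceM; case: ifPn => [_|em]; first exact: spaceM_oddP.
exact: iff_trans (spaceM_even_odd M em) (spaceM_oddP M).
Qed.

(** * Row and column sums of dyadic sums *)

Lemma ones_sigma (R : realType) m : ~~ odd m -> (sigma R m)^T *m ones R m = 0.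
Proof.
move=> em; apply/matrixP=> i j; rewrite !mxE.
transitivity (\sum_(k < m) (-1) ^+ k : R).
  by apply: eq_bigr => k _; rewrite !mxE mulr1.
(* The claim is extended to all m, so that induction can run through both parities. *)
suff -> : \sum_(k < m) (-1) ^+ k = (odd m)%:R :> R by rewrite (negbTE em).
elim: m {em i j} => [|m IHm]; first by rewrite big_ord0.
rewrite big_ord_recr /= IHm -signr_odd.
by case: (odd m); rewrite ?expr1 ?expr0 ?subrr ?add0r.
Qed.

(** As s is orthogonal to [ones], the ith row sum is s_i times the entry sum of y, and likewise for
    columns with x. An alternating sequence is constant only if it vanishes. *)
Lemma spaceS_dyad_sum (R : realType) m (x y : 'cV[R]_m) : ~~ odd m ->
  spaceS R m (dyad_sum x y) <->
  (ones R m)^T *m x = 0 /\ (ones R m)^T *m y = 0.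
Proof.
move=> em.
have row_sum (u v : 'cV[R]_m) i : \sum_j dyad_sum u v i j =
    sigma R m i 0 * ((ones R m)^T *m v) 0 0.
  transitivity ((dyad_sum u v *m ones R m) i 0).
    by rewrite mxE; apply: eq_bigr => j _; rewrite [ones _ _ _ _]mxE mulr1.
  rewrite /dyad_sum mulmxDl -!mulmxA ones_sigma // mulmx0 add0r mxE big_ord1.
  by congr (_ * _); rewrite -[in LHS](trmxK (ones R m)) -trmx_mul mxE.
have col_sum i : \sum_j dyad_sum x y j i =
    sigma R m i 0 * ((ones R m)^T *m x) 0 0.
  rewrite -(row_sum y); apply: eq_bigr => j _.
  by rewrite -[dyad_sum y x]tr_dyad_sum [RHS]mxE.
split=> [[w sw]|[x1 y1]]; last first.
  by exists 0 => i; rewrite row_sum col_sum x1 y1 !mxE !mulr0.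
case: m em x y row_sum col_sum sw => [|m] em x y row_sum col_sum sw.
  by rewrite [x]flatmx0 [y]flatmx0 !mulmx0.
have eq0 (v : 'cV[R]_m.+1) :
    (forall i, sigma R m.+1 i 0 * ((ones R m.+1)^T *m v) 0 0 = m.+1%:R * w) ->
    (ones R m.+1)^T *m v = 0.
  (* Neighbouring indices carry opposite signs, so the entry sum of v equals its own negative. *)
  move=> vw; have := vw (cyc_shift 1 ord0); rewrite -(vw ord0) sigma_shift1 //.
  rewrite mulNr [sigma _ _ _ _]mxE expr0 mul1r => /eqP.
  rewrite eq_sym -addr_eq0 -mulr2n mulrn_eq0 /= => /eqP v0.
  by rewrite [LHS]mx11_scalar v0; apply/scalar11_eq0.
split; apply: eq0 => i; first by rewrite -col_sum; case: (sw i).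
by rewrite -(row_sum x); case: (sw i).
Qed.

(** * The half-period shift and the space P *)

(** The permutation matrix of the shift by nu modulo 2 nu, which exchanges the two halves of the
    indices. *)
Definition swap_mx (R : realType) nu : 'M[R]_(nu + nu) := block_mx 0 1%:M 1%:M 0.

Lemma spacePP (R : realType) nu (M : 'M[R]_(nu + nu)) :
  spaceP R nu M <-> M + swap_mx R nu *m M *m swap_mx R nu = 0.
Proof.
have shl (i : 'I_nu) : cyc_shift nu (lshift nu i) = rshift nu i.
  by apply: val_inj; rewrite /= modn_small addnC // ltn_add2l.
have shr (i : 'I_nu) : cyc_shift nu (rshift nu i) = lshift nu i.
  apply: val_inj; rewrite /= addnAC modnDl modn_small //.
  exact: ltn_addr.
rewrite -[M]submxK /swap_mx !mulmx_block.
rewrite !(mul0mx, mulmx0, mul1mx, mulmx1, add0r, addr0) add_block_mx.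
set A := ulsubmx M; set B := ursubmx M; set C := dlsubmx M; set D := drsubmx M.
split=> [P|E i j].
  apply/matrixP=> i j; rewrite [RHS]mxE.
  case: (split_ordP i) => {}i ->; case: (split_ordP j) => {}j ->;
  rewrite ?(block_mxEul, block_mxEur, block_mxEdl, block_mxEdr) mxE.
  - by have := P (lshift nu i) (lshift nu j); rewrite !shl block_mxEul block_mxEdr.
  - have := P (lshift nu i) (rshift nu j).
    by rewrite shl shr block_mxEur block_mxEdl.
  - have := P (rshift nu i) (lshift nu j).
    by rewrite shl shr block_mxEur block_mxEdl.
  - by have := P (rshift nu i) (rshift nu j); rewrite !shr block_mxEul block_mxEdr.
have := congr1 (fun N : 'M_(nu + nu) => N i j) E; rewrite [RHS]mxE.
case: (split_ordP i) => {}i ->; case: (split_ordP j) => {}j ->;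
  rewrite ?shl ?shr ?(block_mxEul, block_mxEur, block_mxEdl, block_mxEdr) mxE //.
Qed.

Lemma sigma_double (R : realType) nu :
  sigma R (nu + nu) = col_mx (sigma R nu) ((-1) ^+ nu *: sigma R nu).
Proof.
apply/matrixP=> i j; rewrite mxE; case: (split_ordP i) => {}i ->.
  by rewrite col_mxEu mxE.
by rewrite col_mxEd !mxE exprD.
Qed.

Lemma swap_col_mx (R : realType) nu (p q : 'cV[R]_nu) :
  swap_mx R nu *m col_mx p q = col_mx q p.
Proof. by rewrite mul_block_col !mul0mx !mul1mx add0r addr0. Qed.

Lemma tr_swap_mx (R : realType) nu : (swap_mx R nu)^T = swap_mx R nu.
Proof. by rewrite tr_block_mx !trmx0 !trmx1. Qed.

Lemma sign_sqr (R : realType) nu : (-1) ^+ nu * (-1) ^+ nu = 1 :> R.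
Proof. by rewrite -expr2 sqrr_sign. Qed.

Lemma swap_sigma (R : realType) nu :
  swap_mx R nu *m sigma R (nu + nu) = (-1) ^+ nu *: sigma R (nu + nu).
Proof.
by rewrite sigma_double swap_col_mx scale_col_mx scalerA sign_sqr scale1r.
Qed.

Lemma sigma_swap (R : realType) nu :
  (sigma R (nu + nu))^T *m swap_mx R nu = (-1) ^+ nu *: (sigma R (nu + nu))^T.
Proof.
by apply: trmx_inj; rewrite trmx_mul tr_swap_mx linearZ /= !trmxK swap_sigma.
Qed.

(** Since s is an eigenvector of the swap from either side, conjugation preserves the dyadic form
    and acts on x and y separately. *)
Lemma swap_dyad_sum (R : realType) nu (x y : 'cV[R]_(nu + nu)) :
  swap_mx R nu *m dyad_sum x y *m swap_mx R nu =
  dyad_sum ((-1) ^+ nu *: (swap_mx R nu *m x)) ((-1) ^+ nu *: (swap_mx R nu *m y)).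
Proof.
rewrite /dyad_sum mulmxDr mulmxDl !mulmxA swap_sigma -!mulmxA sigma_swap.
have -> (v : 'cV[R]_(nu + nu)) : (((-1) ^+ nu *: (swap_mx R nu *m v))^T =
    (-1) ^+ nu *: (v^T *m swap_mx R nu)).
  by rewrite linearZ /= trmx_mul tr_swap_mx.
by rewrite -!scalemxAr -!scalemxAl !mulmxA.
Qed.

(** * The space MPS as dyadic sums *)

Lemma dyad_sumD (R : realType) m (x y z t : 'cV[R]_m) :
  dyad_sum x y + dyad_sum z t = dyad_sum (x + z) (y + t).
Proof. by rewrite /dyad_sum mulmxDl linearD mulmxDr addrACA. Qed.

(** The sign compensates the factor (-1)^nu that s acquires under the half shift; for odd nu the
    second half therefore repeats p. *)
Definition antiperiodic (R : realType) nu (p : 'cV[R]_nu) : 'cV[R]_(nu + nu) :=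
  col_mx p (- ((-1) ^+ nu *: p)).

Lemma swap_antiperiodic (R : realType) nu (p : 'cV[R]_nu) :
  swap_mx R nu *m antiperiodic p = - ((-1) ^+ nu *: antiperiodic p).
Proof.
rewrite swap_col_mx /antiperiodic scale_col_mx opp_col_mx scalerN opprK scalerA.
by rewrite sign_sqr scale1r.
Qed.

(** The two halves contribute opposite amounts; this supplies the orthogonality demanded by
    [spaceMP]. *)
Lemma sigma_antiperiodic (R : realType) nu (p : 'cV[R]_nu) :
  (sigma R (nu + nu))^T *m antiperiodic p = 0.
Proof.
rewrite sigma_double tr_col_mx mul_row_col mulmxN -scalemxAr [(_ *: _)^T]linearZ /=.
by rewrite -scalemxAl scalerA sign_sqr scale1r subrr.
Qed.

(** By uniqueness, the condition P on a dyadic sum says that x and y are each killed by 1 + (-1)^nu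
    [swap_mx], that is, are antiperiodic. *)
Lemma spaceMPSP (R : realType) nu (M : 'M[R]_(nu + nu)) :
  spaceMPS R nu M <->
  exists p q, [/\ (ones R (nu + nu))^T *m antiperiodic p = 0,
    (ones R (nu + nu))^T *m antiperiodic q = 0 &
    M = dyad_sum (antiperiodic p) (antiperiodic q)].
Proof.
have en : ~~ odd (nu + nu) by rewrite addnn odd_double.
split.
  move=> [[/spaceMP [x [y [sx sy ->]]] /spacePP P]].
  move=> /(spaceS_dyad_sum _ _ en) [x1 y1].
  (* Uniqueness applies only to vectors orthogonal to s, a property that the swap preserves. *)
  have sK (v : 'cV[R]_(nu + nu)) : (sigma R (nu + nu))^T *m v = 0 ->
      (sigma R (nu + nu))^T *m (v + (-1) ^+ nu *: (swap_mx R nu *m v)) = 0.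
    move=> sv; rewrite mulmxDr sv add0r -scalemxAr mulmxA sigma_swap.
    by rewrite -scalemxAl sv !scaler0.
  rewrite swap_dyad_sum dyad_sumD in P.
  have [Px Py] := dyad_sum_eq0 (sK _ sx) (sK _ sy) P.
  have ap (v : 'cV[R]_(nu + nu)) : v + (-1) ^+ nu *: (swap_mx R nu *m v) = 0 ->
      v = antiperiodic (usubmx v).
    rewrite -{1 2}[v]vsubmxK swap_col_mx scale_col_mx add_col_mx -[0]col_mx0.
    case/eq_col_mx => /eqP + _; rewrite addr_eq0 => /eqP uv.
    suff dv : dsubmx v = - ((-1) ^+ nu *: usubmx v).
      by rewrite /antiperiodic -dv vsubmxK.
    by rewrite uv scalerN opprK scalerA sign_sqr scale1r.
  by exists (usubmx x), (usubmx y); rewrite -!ap.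
move=> [p [q [p1 q1 ->]]]; split; last exact/spaceS_dyad_sum.
split.
  by apply/spaceMP; exists (antiperiodic p), (antiperiodic q);
    rewrite !sigma_antiperiodic.
apply/spacePP; rewrite swap_dyad_sum dyad_sumD !swap_antiperiodic !scalerN.
by rewrite !scalerA sign_sqr !scale1r !subrr /dyad_sum trmx0 mul0mx mulmx0 addr0.
Qed.

(** * The reversal matrix J and the space A *)

Lemma mul_Jmx (R : realType) m n (A : 'M[R]_(m, n)) i j :
  (Jmx R m *m A) i j = A (rev_ord i) j.
Proof.
rewrite mxE (bigD1 (rev_ord i)) //= mxE rev_ordK eqxx mul1r big1 ?addr0 // => k.
rewrite mxE -(inj_eq rev_ord_inj) rev_ordK eq_sym => /negbTE ->; exact: mul0r.
Qed.

Lemma tr_Jmx (R : realType) m : (Jmx R m)^T = Jmx R m.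
Proof.
by apply/matrixP=> i j; rewrite !mxE -(inj_eq rev_ord_inj) rev_ordK eq_sym.
Qed.

Lemma Jmx_sqr (R : realType) m : Jmx R m *m Jmx R m = 1%:M.
Proof. by apply/matrixP=> i j; rewrite mul_Jmx !mxE (inj_eq rev_ord_inj). Qed.

Lemma spaceAP (R : realType) m (Z : 'M[R]_m) :
  spaceA R m Z <-> Z + Jmx R m *m Z *m Jmx R m = 0.
Proof.
have E i j : (Z + Jmx R m *m Z *m Jmx R m) i j = Z i j + Z (rev_ord i) (rev_ord j).
  rewrite mxE -[Jmx R m *m Z *m _]trmxK [in X in _ + X]mxE trmx_mul tr_Jmx mul_Jmx.
  by rewrite mxE mul_Jmx.
split=> [AZ|EZ i j]; last by rewrite -E EZ mxE.
by apply/matrixP=> i j; rewrite E AZ mxE.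
Qed.

Lemma Jmx_sigma (R : realType) m :
  Jmx R m *m sigma R m = - ((-1) ^+ m *: sigma R m).
Proof.
apply/matrixP=> i j; rewrite mul_Jmx !mxE /=.
(* The reflection of the 0-based index i is m - (i + 1), which produces the extra minus sign. *)
have -> : (-1) ^+ m = (-1) ^+ (m - i.+1) * (-1) ^+ i.+1 :> R.
  by rewrite -exprD subnK.
by rewrite exprS mulN1r mulrN mulNr opprK -mulrA sign_sqr mulr1.
Qed.

Lemma sigma_Jmx (R : realType) m :
  (sigma R m)^T *m Jmx R m = - ((-1) ^+ m *: (sigma R m)^T).
Proof.
apply: trmx_inj; rewrite trmx_mul tr_Jmx trmxK Jmx_sigma.
by rewrite [RHS]linearN /= [in RHS]linearZ /= trmxK.
Qed.

Lemma Jmx_ones (R : realType) m : (ones R m)^T *m Jmx R m = (ones R m)^T.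
Proof.
apply: trmx_inj; rewrite trmx_mul tr_Jmx trmxK.
by apply/matrixP=> i j; rewrite mul_Jmx !mxE.
Qed.

Lemma Jmx_dyad_sum (R : realType) m (x y : 'cV[R]_m) :
  Jmx R m *m dyad_sum x y *m Jmx R m =
  dyad_sum (- ((-1) ^+ m *: (Jmx R m *m x))) (- ((-1) ^+ m *: (Jmx R m *m y))).
Proof.
rewrite /dyad_sum mulmxDr mulmxDl !mulmxA Jmx_sigma -!mulmxA sigma_Jmx.
have -> : (- ((-1) ^+ m *: (Jmx R m *m y)))^T = - ((-1) ^+ m *: (y^T *m Jmx R m)).
  by rewrite linearN linearZ /= trmx_mul tr_Jmx.
by rewrite !(mulNmx, mulmxN) -!scalemxAr -!scalemxAl !mulmxA.
Qed.

(** * Conjugation by X *)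

Lemma Xmx_sqr (R : realType) nu : Xmx R nu *m Xmx R nu = 1%:M.
Proof.
rewrite /Xmx -scalemxAl -scalemxAr scalerA -invfM -expr2 sqr_sqrtr ?ler0n //.
rewrite mulmx_block Jmx_sqr !(mulmx1, mul1mx, mulmxN, mulNmx) opprK !subrr.
rewrite scale_block_mx !scaler0 [RHS]scalar_mx_block.
by rewrite -mulr2n -scaler_nat scalerA mulVf ?pnatr_eq0 // scale1r.
Qed.

Lemma tr_Xmx (R : realType) nu : (Xmx R nu)^T = Xmx R nu.
Proof.
by rewrite /Xmx linearZ /= tr_block_mx tr_Jmx linearN /= trmx1.
Qed.

(** By [Jmx_sigma] the two terms of the upper half cancel and those of the lower half coincide,
    giving 2 / sqrt 2 = sqrt 2. *)
Lemma Xmx_sigma (R : realType) nu :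
  Xmx R nu *m sigma R (nu + nu) =
  Num.sqrt 2 *: col_mx 0 (- ((-1) ^+ nu *: sigma R nu)).
Proof.
rewrite sigma_double /Xmx -scalemxAl mul_block_col !mul1mx mulNmx mul1mx.
rewrite -scalemxAr Jmx_sigma scalerN scalerA sign_sqr scale1r subrr.
rewrite -opprD -mulr2n -scaler_nat -scalerN !scale_col_mx !scaler0.
congr (col_mx _ _); rewrite scalerA; congr (_ *: _).
have s0 : Num.sqrt 2 != 0 :> R by rewrite gt_eqF // sqrtr_gt0 ltr0n.
by rewrite -{2}[2%:R](sqr_sqrtr (ler0n R 2)) expr2 mulKf.
Qed.

Lemma Xmx_antiperiodic (R : realType) nu (p : 'cV[R]_nu) :
  Xmx R nu *m antiperiodic p =
  (Num.sqrt 2)^-1 *: col_mx (p - (-1) ^+ nu *: (Jmx R nu *m p))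
                            (Jmx R nu *m p + (-1) ^+ nu *: p).
Proof.
rewrite /Xmx -scalemxAl mul_block_col !mul1mx mulNmx mul1mx opprK.
by rewrite mulmxN -scalemxAr.
Qed.

(** As X is symmetric, each dyad u v^T becomes (X u)(X v)^T. The zero upper half of X s empties the
    upper left block, and the factors sqrt 2 and 1 / sqrt 2 cancel. *)
Lemma Xmx_dyad_sum (R : realType) nu (p q : 'cV[R]_nu) :
  Xmx R nu *m dyad_sum (antiperiodic p) (antiperiodic q) *m Xmx R nu =
  block_mx 0 ((Jmx R nu *m p - (-1) ^+ nu *: p) *m (sigma R nu)^T)
    (sigma R nu *m (Jmx R nu *m q - (-1) ^+ nu *: q)^T)
    (dyad_sum (- (p + (-1) ^+ nu *: (Jmx R nu *m p)))
              (- (q + (-1) ^+ nu *: (Jmx R nu *m q)))).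
Proof.
set e := (-1) ^+ nu; set J := Jmx R nu; set s := sigma R nu.
have s0 : Num.sqrt 2 != 0 :> R by rewrite gt_eqF // sqrtr_gt0 ltr0n.
have XX (u v : 'cV[R]_(nu + nu)) : Xmx R nu *m (u *m v^T) *m Xmx R nu =
    (Xmx R nu *m u) *m (Xmx R nu *m v)^T.
  by rewrite trmx_mul tr_Xmx !mulmxA.
have ws (w : 'cV[R]_nu) : w *m (- (e *: s))^T = - (e *: w) *m s^T.
  rewrite [(- _)^T]linearN /= [(_ *: _)^T]linearZ /=.
  by rewrite mulmxN -scalemxAr mulNmx scalemxAl.
(* This handles the dyad containing p; the one containing q is its transpose. *)
have H r : (Xmx R nu *m antiperiodic r) *m (Xmx R nu *m sigma R (nu + nu))^T =
    block_mx 0 ((J *m r - e *: r) *m s^T) 0 (- (r + e *: (J *m r)) *m s^T).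
  rewrite Xmx_antiperiodic Xmx_sigma [(_ *: _)^T]linearZ /=.
  rewrite -scalemxAl -scalemxAr scalerA mulVf // scale1r tr_col_mx mul_col_row.
  rewrite trmx0 !mulmx0 !ws; congr block_mx; congr (_ *m _).
    by rewrite scalerBr scalerA sign_sqr scale1r opprB.
  by rewrite scalerDr scalerA sign_sqr scale1r addrC.
rewrite /dyad_sum mulmxDr mulmxDl !XX H -[X in _ + X]trmxK trmx_mul trmxK H.
rewrite tr_block_mx !trmx0 !trmx_mul !trmxK add_block_mx !addr0 !add0r.
by rewrite /dyad_sum.
Qed.

(** * Passing between p and the pair (a, z) *)

(** Reversal preserves the entry sum, so both sides are (1 - (-1)^nu) times that of p; the condition
    S thus becomes orthogonality of a to [ones]. *)
Lemma ones_antiperiodic (R : realType) nu (p : 'cV[R]_nu) :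
  (ones R (nu + nu))^T *m antiperiodic p =
  (ones R nu)^T *m (Jmx R nu *m p - (-1) ^+ nu *: p).
Proof.
have -> : ones R (nu + nu) = col_mx (ones R nu) (ones R nu).
  by rewrite /ones col_mx_const.
by rewrite tr_col_mx mul_row_col -mulmxDr [RHS]mulmxBr mulmxA Jmx_ones mulmxBr.
Qed.

Lemma Jmx_eigen_solve (R : realType) nu (a z : 'cV[R]_nu) :
  Jmx R nu *m a = - ((-1) ^+ nu *: a) -> Jmx R nu *m z = (-1) ^+ nu *: z ->
  exists p, Jmx R nu *m p - (-1) ^+ nu *: p = a /\
    - (p + (-1) ^+ nu *: (Jmx R nu *m p)) = z.
Proof.
move=> Ja Jz; set e := (-1) ^+ nu in Ja Jz *.
have ee : e * e = 1 := sign_sqr R nu.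
(* Solving a = J p - e p and z = - (p + e J p) with e^2 = 1 gives e a + z = - 2 p. *)
pose p := - (2^-1 *: (e *: a + z)); exists p.
have -> : Jmx R nu *m p = 2^-1 *: (a - e *: z).
  rewrite /p mulmxN -scalemxAr mulmxDr -scalemxAr Ja Jz scalerN scalerA ee.
  by rewrite scale1r -scalerN opprD opprK.
have two0 : 2 != 0 :> R by rewrite pnatr_eq0.
split; apply/matrixP=> i j; rewrite !mxE.
  (* For [ring] e is a free symbol, so 1 + e * e is kept as a factor until [ee] turns it into 2. *)
  have -> : 2^-1 * (a i j - e * z i j) - e * - (2^-1 * (e * a i j + z i j)) =
    2^-1 * ((1 + e * e) * a i j) by ring.
  by rewrite ee mulKf.
have -> : - (- (2^-1 * (e * a i j + z i j)) + e * (2^-1 * (a i j - e * z i j))) =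
    2^-1 * ((1 + e * e) * z i j) by ring.
by rewrite ee mulKf.
Qed.

(** With e = (-1)^nu, (J + e)(J - e) = J^2 - e^2 = 0; this yields the symmetry of a and b in either
    parity. *)
Lemma Jmx_sub (R : realType) nu (p : 'cV[R]_nu) :
  Jmx R nu *m (Jmx R nu *m p - (-1) ^+ nu *: p) =
  - ((-1) ^+ nu *: (Jmx R nu *m p - (-1) ^+ nu *: p)).
Proof.
rewrite mulmxBr mulmxA Jmx_sqr mul1mx -scalemxAr scalerBr scalerA sign_sqr.
by rewrite scale1r opprB.
Qed.

Lemma Jmx_add (R : realType) nu (p : 'cV[R]_nu) :
  Jmx R nu *m - (p + (-1) ^+ nu *: (Jmx R nu *m p)) =
  (-1) ^+ nu *: - (p + (-1) ^+ nu *: (Jmx R nu *m p)).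
Proof.
rewrite mulmxN mulmxDr -scalemxAr mulmxA Jmx_sqr mul1mx scalerN scalerDr scalerA.
by rewrite sign_sqr scale1r addrC.
Qed.

(** By uniqueness, the condition A on a dyadic sum splits into one eigenvector equation for each
    vector. *)
Lemma spaceAM_dyad_sum (R : realType) nu (Z : 'M[R]_nu) :
  (spaceA R nu `&` spaceM R nu) Z <->
  exists z w, [/\ Jmx R nu *m z = (-1) ^+ nu *: z,
    Jmx R nu *m w = (-1) ^+ nu *: w & Z = dyad_sum z w].
Proof.
split=> [[/spaceAP AZ /spaceMP [z [w [sz sw Zzw]]]]|[z [w [Jz Jw ->]]]].
  rewrite Zzw Jmx_dyad_sum dyad_sumD in AZ.
  have sJ (v : 'cV[R]_nu) : (sigma R nu)^T *m v = 0 ->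
      (sigma R nu)^T *m (v - (-1) ^+ nu *: (Jmx R nu *m v)) = 0.
    move=> sv; rewrite mulmxBr sv sub0r -scalemxAr mulmxA sigma_Jmx mulNmx.
    by rewrite -scalemxAl sv !scaler0 oppr0 scaler0 oppr0.
  have [z0 w0] := dyad_sum_eq0 (sJ _ sz) (sJ _ sw) AZ.
  have J (v : 'cV[R]_nu) : v - (-1) ^+ nu *: (Jmx R nu *m v) = 0 ->
      Jmx R nu *m v = (-1) ^+ nu *: v.
    move=> /eqP; rewrite subr_eq0 => /eqP vJ.
    by rewrite {2}vJ scalerA sign_sqr scale1r.
  by exists z, w; split=> //; apply: J.
split; last first.
  (* Here s and v belong to opposite eigenvalues of the symmetric J, so their inner product equals
     its own negative. *)
  have sJ (v : 'cV[R]_nu) : Jmx R nu *m v = (-1) ^+ nu *: v ->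
      (sigma R nu)^T *m v = 0.
    move=> Jv; set c := (sigma R nu)^T *m v.
    have : c = - c.
      rewrite {1}/c -[v]scale1r -(sign_sqr R nu) -scalerA -Jv -scalemxAr mulmxA.
      by rewrite sigma_Jmx mulNmx -scalemxAl scalerN scalerA sign_sqr scale1r.
    move/eqP; rewrite -addr_eq0 -mulr2n -scaler_nat scaler_eq0 pnatr_eq0 /=.
    by move/eqP.
  by apply/spaceMP; exists z, w; rewrite !sJ.
apply/spaceAP; rewrite Jmx_dyad_sum dyad_sumD Jz Jw !scalerA sign_sqr !scale1r.
by rewrite !subrr /dyad_sum trmx0 mul0mx mulmx0 addr0.
Qed.

Theorem theorem13 (R : realType) (nu : nat) (M : 'M[R]_(nu + nu)) :
  spaceMPS R nu M <->
  exists (a b : 'cV[R]_nu) (Z : 'M[R]_nu),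
    [/\ perp [set ones R nu] a /\ perp [set ones R nu] b,
        ~~ odd nu -> Jmx R nu *m a = - a /\ Jmx R nu *m b = - b,
        odd nu -> Jmx R nu *m a = a /\ Jmx R nu *m b = b,
        (spaceA R nu `&` spaceM R nu) Z
      & M = Xmx R nu
              *m block_mx 0 (a *m (sigma R nu)^T) (sigma R nu *m b^T) Z
              *m Xmx R nu].
Proof.
have even_sign (v : 'cV[R]_nu) : ~~ odd nu -> - ((-1) ^+ nu *: v) = - v.
  by move=> /negbTE en; rewrite -signr_odd en expr0 scale1r.
have odd_sign (v : 'cV[R]_nu) : odd nu -> - ((-1) ^+ nu *: v) = v.
  by move=> on; rewrite -signr_odd on expr1 scaleN1r opprK.
have XNX (N : 'M[R]_(nu + nu)) :
    Xmx R nu *m (Xmx R nu *m N *m Xmx R nu) *m Xmx R nu = N.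
  by rewrite !mulmxA Xmx_sqr mul1mx -mulmxA Xmx_sqr mulmx1.
rewrite spaceMPSP; split.
  move=> [p [q [p1 q1 ->]]].
  rewrite -[dyad_sum _ _]XNX Xmx_dyad_sum.
  (* Unification with the computed block form fixes a, b and Z. *)
  do 3![eexists]; split; last reflexivity.
  - by split; apply/perp_set1; rewrite -ones_antiperiodic.
  - by move=> en; rewrite !Jmx_sub !even_sign.
  - by move=> on; rewrite !Jmx_sub !odd_sign.
  - by apply/spaceAM_dyad_sum; do 2![eexists]; split; last reflexivity;
      apply: Jmx_add.
move=> [a [b [Z [[/perp_set1 a1 /perp_set1 b1] en on]]]].
move=> /spaceAM_dyad_sum [z [w [Jz Jw ->]]] ->.
(* Both parity clauses express the single eigenvalue - (-1)^nu. *)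
have [Ja Jb] : Jmx R nu *m a = - ((-1) ^+ nu *: a) /\
    Jmx R nu *m b = - ((-1) ^+ nu *: b).
  by case: (boolP (odd nu)) => h; [rewrite !odd_sign //; apply: on|
    rewrite !even_sign //; apply: en].
have [p [pa pz]] := Jmx_eigen_solve Ja Jz.
have [q [qb qw]] := Jmx_eigen_solve Jb Jw.
exists p, q; rewrite !ones_antiperiodic pa qb; split=> //.
by rewrite -[RHS]XNX Xmx_dyad_sum pa qb pz qw.
Qed.
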